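(* Let $g\geq 2$ and let $\langle F,G\rangle<\mathrm{Mod}(S_g)$ be a non-abelian infinite metacyclic subgroup with $\langle F\rangle\lhd\langle F,G\rangle$, where $F$ is pseudo-Anosov and $G$ is nontrivial periodic. Then, for integers $i,j$ such that $i$ is odd and $j$ is even, $G^iF^j$ is conjugate to $G^i$. In particular, $GF^2$ is conjugate to $G$, and therefore $F^2$ can be written as a product of two nontrivial periodic mapping classes of the same order.
   Context: $S_g$ is the closed connected orientable surface of genus $g$ and $\mathrm{Mod}(S_g)$ its mapping class group. A metacyclic group is an extension of a cyclic group by a cyclic group; when $\langle F,G\rangle$ is metacyclic with $\langle F\rangle\lhd\langle F,G\rangle$, one has $G^{-1}FG=F^k$ for some nonzero integer $k$. *)

(* Defs.v *)
From HB Require Import structures.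
From mathcomp Require Import all_boot all_order all_algebra generic_quotient.
From mathcomp Require Import all_classical all_reals all_analysis.

Set Implicit Arguments.
Unset Strict Implicit.
Unset Printing Implicit Defensive.

Import Order.TTheory GRing.Theory Num.Theory.
Import numFieldNormedType.Exports.
Local Open Scope classical_set_scope.
Local Open Scope ring_scope.
Local Open Scope quotient_scope.

Section Groups.
Variable T : groupType.
Implicit Types (x y : T) (H N : set T).

Definition zexpg x (i : int) : T :=
  match i with Posz n => (x ^+ n)%g | Negz n => (x ^- n.+1)%g end.

Definition is_subgroup H : Prop :=
  H 1%g /\ forall x y, H x -> H y -> H (x / y)%g.

Definition generated (A : set T) : set T :=
  [set x | forall H, is_subgroup H -> A `<=` H -> H x].

Definition is_normal N H : Prop :=
  [/\ is_subgroup N, N `<=` H & forall x h, N x -> H h -> N (h^-1 * x * h)%g].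

Definition is_cyclic H : Prop := exists x, H = generated [set x].

(* The last clause says that H / N is cyclic, generated by the coset y N. *)
Definition is_metacyclic H : Prop :=
  exists N, [/\ is_normal N H, is_cyclic N &
    exists2 y, H y & forall x, H x -> exists i : int, N ((zexpg y i)^-1 * x)%g].

Definition is_abelian H : Prop :=
  forall x y, H x -> H y -> (x * y = y * x)%g.

Definition is_conjugate x y : Prop := exists z, x = (z^-1 * y * z)%g.

Definition is_periodic x : Prop := exists2 n : nat, (0 < n)%N & (x ^+ n = 1)%g.

Definition has_order x (n : nat) : Prop :=
  [/\ (0 < n)%N, (x ^+ n = 1)%g &
      forall m : nat, (0 < m)%N -> (x ^+ m = 1)%g -> (n <= m)%N].

End Groups.

Section Surfaces.
Variables (R : realType) (S : topologicalType).

(* A chart is a local coordinate map to the plane; only the values of [cmap]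
   on the domain [cdom] are meaningful. *)
Record chart := Chart { cdom : set S ; cmap : S -> R * R }.

Definition is_chart (c : chart) : Prop :=
  [/\ open (cdom c),
      {in cdom c &, injective (cmap c)},
      {within cdom c, continuous (cmap c)} &
      forall V, open V -> V `<=` cdom c -> open (cmap c @` V)].

Definition polar (r t : R) : R * R := (r * cos t, r * sin t).

(* The loop l, restricted to [0, 1], avoids the point a and has winding
   number +1 about it. *)
Definition winds_once (l : R -> R * R) (a : R * R) : Prop :=
  exists rho theta : R -> R,
  [/\ {within `[0, 1], continuous theta},
      forall t, t \in `[0, 1] -> 0 < rho t /\ l t = a + polar (rho t) (theta t) &
      theta 1 - theta 0 = 2 * pi].

(* The transition map from c to d has local degree +1 at every point: it sends
   small positively oriented circles to loops of winding number +1. *)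
Definition co_oriented (c d : chart) : Prop :=
  forall p, cdom c p -> cdom d p -> \forall r \near (0 : R)^'+,
  exists2 gam : R -> S,
    (forall t, t \in `[0, 1] ->
      [/\ cdom c (gam t), cdom d (gam t) &
          cmap c (gam t) = cmap c p + polar r (2 * pi * t)]) &
    winds_once (cmap d \o gam) (cmap d p).

(* An orientation is a maximal oriented atlas; a connected orientable surface
   has exactly two of them. *)
Definition is_orientation (A : set chart) : Prop :=
  [/\ A `<=` is_chart,
      forall p, exists2 c, A c & cdom c p,
      forall c d, A c -> A d -> co_oriented c d &
      forall c, is_chart c -> (forall d, A d -> co_oriented c d) -> A c].

Definition is_simple_closed_curve (C : set S) : Prop :=
  exists gam : R -> S,
  [/\ continuous gam,
      forall s t, gam s = gam t <-> exists n : int, s - t = n%:~R &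
      C = range gam].

(* n disjoint simple closed curves that together do not disconnect S *)
Definition has_cut_system (n : nat) : Prop :=
  exists C : 'I_n -> set S,
  [/\ forall i, is_simple_closed_curve (C i),
      forall i j, i != j -> C i `&` C j = set0 &
      connected (~` \bigcup_i C i)].

Definition has_genus (g : nat) : Prop :=
  has_cut_system g /\ forall n, has_cut_system n -> (n <= g)%N.

(* Second countability follows from compactness. *)
Definition closed_orientable_surface (g : nat) : Prop :=
  [/\ compact [set: S] /\ hausdorff_space S,
      connected [set: S],
      forall p, exists2 c, is_chart c & cdom c p,
      exists A, is_orientation A &
      has_genus g].

Definition pull_chart (f : S -> S) (c : chart) : chart :=
  Chart (f @^-1` cdom c) (cmap c \o f).

Definition orientation_preserving (f : S -> S) : Prop :=
  forall A, is_orientation A -> forall c, A (pull_chart f c) <-> A c.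

(* orientation-preserving self-homeomorphisms of S *)
Record homeo := Homeo {
  hfun :> S -> S ;
  hinv : S -> S ;
  hfunK : cancel hfun hinv ;
  hinvK : cancel hinv hfun ;
  hfun_continuous : continuous hfun ;
  hinv_continuous : continuous hinv ;
  hfun_orientation : orientation_preserving hfun }.

HB.instance Definition _ := gen_eqMixin homeo.
HB.instance Definition _ := gen_choiceMixin homeo.

Lemma homeoP (f g : homeo) : f =1 g -> f = g.
Proof.
case: f g => [f f' fK f'K fc f'c fo] [g g' gK g'K gc g'c go] /= /funext fg.
subst g; have fg' : f' = g'.
  by apply/funext => x; rewrite -{1}(g'K x) fK.
by subst g'; congr Homeo; exact: Prop_irrelevance.
Qed.

Lemma homeo_id_orientation : orientation_preserving idfun.
Proof. by move=> A _ [U u]. Qed.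

Definition homeo_one : homeo :=
  Homeo (fun=> erefl) (fun=> erefl) (fun x => @cvg_id _ _) (fun x => @cvg_id _ _)
    homeo_id_orientation.

Lemma homeo_mul_orientation (f g : homeo) : orientation_preserving (f \o g).
Proof.
move=> A oA c.
exact: iff_trans (hfun_orientation g oA (pull_chart f c))
                 (hfun_orientation f oA c).
Qed.

Lemma homeo_mul_continuous (f g : S -> S) :
  continuous f -> continuous g -> continuous (f \o g).
Proof. by move=> fc gc x; apply: continuous_comp; [exact: gc|exact: fc]. Qed.

Definition homeo_mul (f g : homeo) : homeo :=
  @Homeo (f \o g) (hinv g \o hinv f)
    (can_comp (hfunK f) (hfunK g)) (can_comp (hinvK g) (hinvK f))
    (homeo_mul_continuous (@hfun_continuous f) (@hfun_continuous g))
    (homeo_mul_continuous (@hinv_continuous g) (@hinv_continuous f))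
    (homeo_mul_orientation f g).

Lemma homeo_inv_orientation (f : homeo) : orientation_preserving (hinv f).
Proof.
move=> A oA c; apply: iff_trans; first exact: iff_sym (hfun_orientation f oA _).
suff -> : pull_chart f (pull_chart (hinv f) c) = c by [].
case: c => U u; congr Chart; apply/funext => x /=; by rewrite ?/preimage /= hfunK.
Qed.

Definition homeo_inv (f : homeo) : homeo :=
  Homeo (hinvK f) (hfunK f) (@hinv_continuous f) (@hfun_continuous f)
    (@homeo_inv_orientation f).

Fact homeo_mulA : associative homeo_mul. Proof. by move=> f g h; exact: homeoP. Qed.
Fact homeo_mul1 : left_id homeo_one homeo_mul. Proof. by move=> f; exact: homeoP. Qed.
Fact homeo_mulr1 : right_id homeo_one homeo_mul.
Proof. by move=> f; exact: homeoP. Qed.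
Fact homeo_mulV : left_inverse homeo_one homeo_inv homeo_mul.
Proof. by move=> f; apply: homeoP => x; exact: hfunK. Qed.
Fact homeo_mulrV : right_inverse homeo_one homeo_inv homeo_mul.
Proof. by move=> f; apply: homeoP => x; exact: hinvK. Qed.

HB.instance Definition _ := isGroup.Build homeo
  homeo_mulA homeo_mul1 homeo_mulr1 homeo_mulV homeo_mulrV.

Definition isotopic (f g : homeo) : Prop :=
  exists H : R -> homeo,
  [/\ {within `[0, 1] `*` [set: S], continuous (fun z : R * S => H z.1 z.2)},
      H 0 = f & H 1 = g].

Lemma within_comp (T U V : topologicalType) (A : set T) (B : set U)
    (f : T -> U) (g : U -> V) :
  (forall x, A x -> B (f x)) -> {within A, continuous f} ->
  {within B, continuous g} -> {within A, continuous (g \o f)}.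
Proof.
move=> AB /subspace_continuousP fc /subspace_continuousP gc.
apply/subspace_continuousP => x Ax.
apply: (@cvg_comp _ _ _ f g _ (within B (nbhs (f x)))); last exact/gc/AB.
move=> W BW; have := fc x Ax _ BW; rewrite /nbhs /= /within /= => h.
near=> y; move=> Ay; have : A y -> B (f y) -> W (f y) by near: y; exact: h.
by apply=> //; exact: AB.
Unshelve. all: by end_near. Qed.

Lemma cvg_to_pair (T : Type) (U V : topologicalType) (F : set_system T)
    {FF : Filter F} (f : T -> U) (g : T -> V) (a : U) (b : V) :
  f @ F --> a -> g @ F --> b -> (f x, g x) @[x --> F] --> ((a, b) : U * V).
Proof. exact: cvg_pair. Qed.

Lemma isotopic_refl f : isotopic f f.
Proof.
exists (fun=> f); split=> //; apply: continuous_subspaceT => z.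
by apply: continuous_comp; [exact: cvg_snd|exact: hfun_continuous].
Qed.

Lemma isotopic_sym f g : isotopic f g -> isotopic g f.
Proof.
move=> [H [Hc H0 H1]]; exists (fun t => H (1 - t)); split; first last.
- by rewrite subrr.
- by rewrite subr0.
apply: (@within_comp (R * S)%type (R * S)%type S _ (`[0, 1] `*` [set: S])
  (fun z : R * S => (1 - z.1, z.2)) (fun z : R * S => H z.1 z.2)) => //.
  move=> [t x] /= [+ _]; rewrite !in_itv /= => /andP[t0 t1].
  by split=> //; rewrite subr_ge0 t1 gerBl t0.
apply: continuous_subspaceT => z; apply: cvg_to_pair; last exact: cvg_snd.
by apply: cvgB; [exact: cvg_cst|exact: cvg_fst].
Qed.

Lemma isotopic_trans f g h : isotopic f g -> isotopic g h -> isotopic f h.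
Proof.
move=> [H [Hc H0 H1]] [K [Kc K0 K1]].
pose L t := if t <= 2^-1 then H (2 * t) else K (2 * t - 1).
have LK t : 2^-1 <= t -> L t = K (2 * t - 1).
  rewrite le_eqVlt /L => /predU1P[<-|]; last by rewrite ltNge => /negbTE ->.
  by rewrite lexx divff // subrr H1 K0.
exists L; split; first last.
- rewrite LK ?mulr1 ?invf_le1 ?ler1n //.
  by rewrite (_ : 2 - 1 = 1) // -[X in X - 1]/(1 + 1) addrK.
- by rewrite /L invr_ge0 ler0n mulr0.
have -> : `[0 : R, 1 : R]%classic `*` [set: S] =
    (`[0 : R, 2^-1]%classic `*` [set: S]) `|` (`[2^-1, 1 : R]%classic `*` [set: S]).
  apply/seteqP; split=> -[t x] /=; rewrite !in_itv /=.
    move=> [/andP[-> ->] _]; rewrite !andbT.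
    by case: (leP t 2^-1) => [|/ltW]; [left|right].
  move=> [] [/andP[a b] _]; split=> //; apply/andP; split=> //.
    by rewrite (le_trans b) // invf_le1 ?ler1n.
  by rewrite (le_trans _ a) // invr_ge0.
have cl (a b : R) : closed (`[a, b]%classic `*` [set: S]).
  rewrite (_ : _ `*` _ = fst @^-1` `[a, b]%classic); last first.
    by apply/seteqP; split=> [z []|z ?] //.
  by apply: closed_comp => [z _|]; [exact: cvg_fst|exact: itv_closed].
apply: withinU_continuous => //.
- apply: (@subspace_eq_continuous _ _ _
    ((fun z : R * S => H z.1 z.2) \o (fun z : R * S => (2 * z.1, z.2)))).
    move=> [t x] /set_mem /= [+ _]; rewrite in_itv /= => /andP[_ t2].
    by rewrite /from_subspace /L /= t2.
  apply: (@within_comp (R * S)%type (R * S)%type S _ (`[0, 1] `*` [set: S])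
    _ (fun z : R * S => H z.1 z.2)) => //.
    move=> [t x] /= [+ _]; rewrite !in_itv /= => /andP[t0 t1]; split=> //.
    by rewrite mulr_ge0 //= mulrC -ler_pdivlMr // mul1r.
  apply: continuous_subspaceT => z; apply: cvg_to_pair; last exact: cvg_snd.
  by apply: cvgM; [exact: cvg_cst|exact: cvg_fst].
- apply: (@subspace_eq_continuous _ _ _
    ((fun z : R * S => K z.1 z.2) \o (fun z : R * S => (2 * z.1 - 1, z.2)))).
    move=> [t x] /set_mem /= [+ _]; rewrite in_itv /= => /andP[t2 _].
    by rewrite /from_subspace /= LK.
  apply: (@within_comp (R * S)%type (R * S)%type S _ (`[0, 1] `*` [set: S])
    _ (fun z : R * S => K z.1 z.2)) => //.
    move=> [t x] /= [+ _]; rewrite !in_itv /= => /andP[t0 t1]; split=> //.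
    rewrite subr_ge0 mulrC -ler_pdivrMr // mul1r t0 /=.
    by rewrite lerBlDr -[leRHS]/(2%:R) -[leRHS]mul1r ler_pM2r.
  apply: continuous_subspaceT => z; apply: cvg_to_pair; last exact: cvg_snd.
  apply: cvgB; last exact: cvg_cst.
  by apply: cvgM; [exact: cvg_cst|exact: cvg_fst].
Qed.

Lemma isotopic_mul f f' g g' :
  isotopic f f' -> isotopic g g' -> isotopic (f * g)%g (f' * g')%g.
Proof.
move=> [H [Hc H0 H1]] [K [Kc K0 K1]].
exists (fun t => (H t * K t)%g); split; rewrite ?H0 ?H1 ?K0 ?K1 //.
apply: (@within_comp (R * S)%type (R * S)%type S _ (`[0, 1] `*` [set: S])
  (fun z : R * S => (z.1, K z.1 z.2)) (fun z : R * S => H z.1 z.2)) => //.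
apply/subspace_continuousP => z zA; apply: cvg_to_pair.
  by apply: cvg_trans (cvg_app _ (@cvg_within _ _ _ _)) _; exact: cvg_fst.
by move/subspace_continuousP: Kc; exact.
Qed.

Lemma isotopic_inv f f' : isotopic f f' -> isotopic (f^-1)%g (f'^-1)%g.
Proof.
move=> ff'.
have := isotopic_mul (isotopic_mul (isotopic_refl f^-1%g) ff')
                     (isotopic_refl f'^-1%g).
by rewrite mulVg mul1g mulgK => /isotopic_sym.
Qed.

Definition isotopicb (f g : homeo) : bool := `[< isotopic f g >].

Fact isotopicb_refl : reflexive isotopicb.
Proof. by move=> f; apply/asboolP/isotopic_refl. Qed.
Fact isotopicb_sym : symmetric isotopicb.
Proof. by move=> f g; apply/asboolP/asboolP; exact: isotopic_sym. Qed.
Fact isotopicb_trans : transitive isotopicb.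
Proof.
move=> g f h /asboolP fg /asboolP gh; apply/asboolP; exact: isotopic_trans gh.
Qed.

Canonical isotopic_equiv :=
  EquivRel isotopicb isotopicb_refl isotopicb_sym isotopicb_trans.

(* pi_0 of the group of orientation-preserving homeomorphisms; the product is
   induced by composition, g * f being f followed by g. *)
Definition Mod : Type := {eq_quot isotopicb}.
HB.instance Definition _ := EqQuotient.on Mod.
HB.instance Definition _ := Choice.on Mod.

Definition mapping_class (f : homeo) : Mod := \pi_Mod f.

Lemma mapping_classP f g : mapping_class f = mapping_class g <-> isotopic f g.
Proof.
by rewrite /mapping_class; split=> [/eqmodP/asboolP|fg] //; exact/eqmodP/asboolP.
Qed.

Lemma mapping_class_repr (a : Mod) : mapping_class (repr a) = a.
Proof. exact: reprK. Qed.

Definition Mod_one : Mod := mapping_class 1%g.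
Definition Mod_mul (a b : Mod) : Mod := mapping_class (repr a * repr b)%g.
Definition Mod_inv (a : Mod) : Mod := mapping_class (repr a)^-1%g.

Lemma Mod_mulE f g :
  Mod_mul (mapping_class f) (mapping_class g) = mapping_class (f * g)%g.
Proof.
by apply/mapping_classP/isotopic_mul; apply/mapping_classP/mapping_class_repr.
Qed.

Lemma Mod_invE f : Mod_inv (mapping_class f) = mapping_class f^-1%g.
Proof. by apply/mapping_classP/isotopic_inv/mapping_classP/mapping_class_repr. Qed.

Fact Mod_mulA : associative Mod_mul.
Proof.
move=> a b c; rewrite -(mapping_class_repr a) -(mapping_class_repr b).
by rewrite -(mapping_class_repr c) !Mod_mulE mulgA.
Qed.
Fact Mod_mul1 : left_id Mod_one Mod_mul.
Proof. by move=> a; rewrite -(mapping_class_repr a) Mod_mulE mul1g. Qed.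
Fact Mod_mulr1 : right_id Mod_one Mod_mul.
Proof. by move=> a; rewrite -(mapping_class_repr a) Mod_mulE mulg1. Qed.
Fact Mod_mulV : left_inverse Mod_one Mod_inv Mod_mul.
Proof. by move=> a; rewrite -(mapping_class_repr a) Mod_invE Mod_mulE mulVg. Qed.
Fact Mod_mulrV : right_inverse Mod_one Mod_inv Mod_mul.
Proof. by move=> a; rewrite -(mapping_class_repr a) Mod_invE Mod_mulE mulgV. Qed.

HB.instance Definition _ := isGroup.Build Mod
  Mod_mulA Mod_mul1 Mod_mulr1 Mod_mulV Mod_mulrV.

(* Foliation boxes are charts (x, y) whose leaves are the segments y = const and
   whose transverse measure is |dy|. *)
Definition height (c : chart) (q : S) : R := (cmap c q).2.

(* |d (height c)| = lam |d (height d)| near p *)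
Definition height_agree (lam : R) (c d : chart) (p : S) : Prop :=
  exists s a : R, (s = 1 \/ s = - 1) /\
    \forall q \near p, height c q = s * lam * height d q + a.

(* The chart z = rho e^(i theta) centred at p carries the leaves and transverse
   measure of the box c to those of |Im d(z^(k/2))|, the standard singularity
   with k prongs. *)
Definition prong_chart (boxes : set chart) (k : nat) (z : chart) (p : S) : Prop :=
  [/\ is_chart z, cdom z p, cmap z p = 0 &
  forall c q, boxes c -> cdom c q -> cdom z q ->
  exists s a : R, exists rho theta : S -> R, (s = 1 \/ s = - 1) /\
    \forall q' \near q,
      [/\ {for q', continuous theta},
          0 < rho q',
          cmap z q' = polar (rho q') (theta q') &
          height c q' = s * (rho q' `^ (k%:R / 2) * sin (k%:R / 2 * theta q')) + a]].

(* The changes of boxes have the form (x, y) |-> (f(x, y), a +- y); no 1-prong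
   singularities, since the surface is closed. *)
Record measured_foliation := MeasuredFoliation {
  sing : set S ;
  boxes : set chart ;
  sing_finite : finite_set sing ;
  boxes_chart : boxes `<=` is_chart ;
  boxes_cover : \bigcup_(c in boxes) cdom c = ~` sing ;
  boxes_compat : forall c d p, boxes c -> boxes d -> cdom c p -> cdom d p ->
    height_agree 1 c d p ;
  sing_prong : forall p, sing p -> exists k z, [/\ (3 <= k)%N,
    cdom z `&` sing = [set p] & prong_chart boxes k z p] }.

(* Away from the common singular set the two foliations are locally the
   horizontal and vertical foliations of the plane. *)
Definition transverse (M N : measured_foliation) : Prop :=
  sing M = sing N /\
  forall c d p, boxes M c -> boxes N d -> cdom c p -> cdom d p ->
  exists2 U : set S, U p & is_chart (Chart U (fun q => (height d q, height c q))).

(* f maps leaves to leaves and f . mu = lam mu, where (f . mu)(arc) is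
   mu(f^-1 (arc)). *)
Definition scales (f : homeo) (M : measured_foliation) (lam : R) : Prop :=
  f @` sing M = sing M /\
  forall c d p, boxes M c -> boxes M d -> cdom c (hinv f p) -> cdom d p ->
  height_agree lam (pull_chart (hinv f) c) d p.

Definition pseudo_Anosov_homeo (f : homeo) : Prop :=
  exists (Fu Fs : measured_foliation) (lam : R),
  [/\ transverse Fu Fs, 1 < lam, scales f Fu lam & scales f Fs lam^-1].

Definition pseudo_Anosov (a : Mod) : Prop :=
  exists2 f, mapping_class f = a & pseudo_Anosov_homeo f.

End Surfaces.

(* Main.v *)
(* If F had finite order, the group <G><F> would be finite; so F has infinite
   order. Writing G^-1 F G = F^k and n for the order of G, conjugation by G^n = 1
   gives F = F^(k^n), hence k = 1 or k = -1, and k = -1 as F and G do not commute.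
   Conjugating G^i by F^m then gives G^i F^(2m) for i odd, and F^2 = G^-1 (G F^2). *)
Require Import Defs.
From mathcomp Require Import all_boot all_order all_algebra.
From mathcomp Require Import all_classical all_reals all_analysis.

Local Open Scope classical_set_scope.

Section PeriodicNormalizer.
Set Implicit Arguments.
Unset Strict Implicit.
Import Order.TTheory GRing.Theory Num.Theory.
Local Open Scope ring_scope.
Variable T : groupType.
Implicit Types (x y z : T) (i j : int) (A : set T).

(** With [int_subnat], this reduces the addition law for integer exponents to natural powers and
    avoids a case analysis on signs there. *)
Lemma zexpgB_nat x (m n : nat) : zexpg x (m%:Z - n%:Z) = (x ^+ m / x ^+ n)%g.
Proof.
have [le_nm|lt_mn] := leqP n m; first by rewrite subzn //= expgnFr.
rewrite -opprB subzn ?(ltnW lt_mn) //.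
have := lt_mn; rewrite -subn_gt0; case E: (n - m)%N => [//|k] _.
rewrite -NegzE /= -E expgnFr ?(ltnW lt_mn) //.
by rewrite invgM invgK.
Qed.

Lemma int_subnat i : exists m n : nat, i = m%:Z - n%:Z.
Proof.
case: i => n; first by exists n, 0%N; rewrite subr0.
by exists 0%N, n.+1; rewrite sub0r NegzE.
Qed.

Lemma zexpgD x i j : zexpg x (i + j) = (zexpg x i * zexpg x j)%g.
Proof.
have [[a [b ->]] [c [d ->]]] := (int_subnat i, int_subnat j).
(* Both sums are swapped so that the inverse of [x ^+ d] ends up last on each side and cancels; only
   [x ^+ c] then has to be moved. *)
rewrite addrACA -opprD -!PoszD !zexpgB_nat addnC [(b + d)%N]addnC !expgnDr.
rewrite invgM !mulgA; congr (_ / _)%g.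
have cxx : commute (x ^+ c) (x ^+ a / x ^+ b)%g.
  apply: commuteM; first by apply: commuteX2.
  by apply/commuteV/commuteX2.
by rewrite -cxx mulgA.
Qed.

Lemma zexpgN x i : zexpg x (- i) = ((zexpg x i)^-1)%g.
Proof. by apply/esym/mulg1_eq; rewrite -zexpgD subrr. Qed.

Lemma zexpgMn x i (n : nat) : zexpg x (i *+ n) = (zexpg x i ^+ n)%g.
Proof. by elim: n => // n IHn; rewrite mulrS zexpgD IHn expgS. Qed.

Lemma zexpgM x i j : zexpg x (i * j) = zexpg (zexpg x i) j.
Proof.
have iM (n : nat) : i * n%:Z = i *+ n by rewrite -natz mulr_natr.
by case: j => n; rewrite ?NegzE ?mulrN ?zexpgN iM zexpgMn.
Qed.

Lemma conj_zexpg x y i : (zexpg x i ^ y = zexpg (x ^ y) i)%g.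
Proof. by case: i => n /=; rewrite ?conjVg conjXg. Qed.

Lemma zexpg_eq1 x i :
  ~ is_periodic x -> zexpg x i = 1%g -> i = 0.
Proof.
move=> xNper; case: i => [[//|n]|n] /= xn; case: xNper; exists n.+1 => //.
by apply: invg_inj; rewrite xn invg1.
Qed.

Lemma is_subgroupM A x y : is_subgroup A -> A x -> A y -> A (x * y)%g.
Proof.
move=> [A1 AF] Ax Ay; rewrite -[y]invgK; apply: (AF) => //.
by rewrite -[(_^-1)%g]mul1g; exact: AF.
Qed.

Lemma is_subgroup_zexpg A x i : is_subgroup A -> A x -> A (zexpg x i).
Proof.
move=> AS Ax; have AX n : A (x ^+ n)%g.
  elim: n => [|n IHn]; first by case: AS.
  by rewrite expgS; exact: is_subgroupM.
case: i => n /=; first exact: AX.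
by rewrite -[(_^-1)%g]mul1g; have [A1] := AS; apply.
Qed.

Lemma sub_generated A : A `<=` generated A.
Proof. by move=> x Ax H _; exact. Qed.

Lemma generated_is_subgroup A : is_subgroup (generated A).
Proof.
split=> [H [] //|x y Ax Ay H HS AH].
by case: (HS) => _; apply; [exact: Ax|exact: Ay].
Qed.

Lemma generated1 x : generated [set x] = range (zexpg x).
Proof.
apply/seteqP; split=> [y|y [i _ <-]]; last first.
  by apply: is_subgroup_zexpg (generated_is_subgroup _) _; exact: sub_generated.
apply; last by move=> _ ->; exists 1.
split; first by exists 0.
by move=> _ _ [i _ <-] [j _ <-]; exists (i - j); rewrite // zexpgD zexpgN.
Qed.

(** A centralizer is a subgroup. Used first for [A], then for [generated A], this extends
    commutation from the generators to one factor and then to both. *)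
Lemma generated_abelian A :
  (forall x y, A x -> A y -> commute x y) -> is_abelian (generated A).
Proof.
move=> cAA.
have centS B : is_subgroup [set x | forall y, B y -> commute x y].
  split=> [y _|x y cxB cyB z Bz]; first exact/commute_sym/commute1.
  apply/commute_sym/commuteM; first exact/commute_sym/cxB.
  exact/commuteV/commute_sym/cyB.
have cgA x : generated A x -> forall y, A y -> commute x y.
  by move=> gx; apply: (gx _ (centS A)) => z Az w; exact: cAA.
move=> x y gx gy; apply: (gx _ (centS (generated A))) => // z Az w gw.
exact/commute_sym/cgA.
Qed.

Lemma zexpg_finite x : is_periodic x -> finite_set (range (zexpg x)).
Proof.
move=> [n n_gt0 xn1].
apply: (@sub_finite_set _ _ ((fun k => (x ^+ k)%g) @` `I_n)); last first.
  exact/finite_image/finite_II.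
have n0 : n%:Z != 0 by rewrite eqz_nat -lt0n.
move=> _ [i _ <-]; exists `|(i %% n%:Z)%Z|%N => /=.
  by rewrite -ltz_nat gez0_abs ?modz_ge0 ?ltz_pmod.
rewrite -[(x ^+ _)%g]/(zexpg x `|(i %% n%:Z)%Z|%N%:Z) gez0_abs ?modz_ge0 //.
(* Only the remainder of [i] modulo [n] matters, since [x ^+ n] is trivial. *)
rewrite [in RHS](divz_eq i n%:Z) [RHS]zexpgD [(_ * n%:Z)]mulrC.
rewrite [X in (X * _)%g]zexpgM /= xn1.
by case: (i %/ n%:Z)%Z => k; rewrite /= expg1n ?invg1 mul1g.
Qed.

(** Normality of the subgroup generated by [x] makes the set of products y^u x^v a subgroup, and it
    contains both generators. *)
Lemma generated2_normal x y :
  is_normal (generated [set x]) (generated [set x; y]) ->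
  generated [set x; y] `<=`
    [set (u * v)%g | u in range (zexpg y) & v in range (zexpg x)].
Proof.
move=> [_ _ nxy] z; apply; last first.
  move=> _ [->|->]; first by exists 1%g; [exists 0|exists x; [exists 1|rewrite mul1g]].
  by exists y; [exists 1|exists 1%g; [exists 0|rewrite mulg1]].
split; first by exists 1%g; [exists 0|exists 1%g; [exists 0|rewrite mulg1]].
move=> _ _ [_ [i _ <-] [_ [j _ <-] <-]] [_ [k _ <-] [_ [l _ <-] <-]].
(* (y^i x^j)(y^k x^l)^-1 = y^i x^(j-l) y^(-k) = y^(i-k) (y^k x^(j-l) y^(-k)), and normality puts the
   last factor among the powers of [x]. *)
exists (zexpg y (i - k)); first by exists (i - k).
exists ((zexpg x (j - l)) ^ (zexpg y (- k)))%g.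
  rewrite -generated1 conjgE mulgA; apply: nxy.
    by rewrite generated1; exists (j - l).
  apply: is_subgroup_zexpg (generated_is_subgroup _) _.
  by apply: sub_generated; right.
by rewrite conjgE !zexpgD !zexpgN !gnorm.
Qed.

Lemma periodic_normalizer_inverts x y :
  ~ is_abelian (generated [set x; y]) -> infinite_set (generated [set x; y]) ->
  is_normal (generated [set x]) (generated [set x; y]) -> is_periodic y ->
  (x ^ y = x^-1)%g.
Proof.
move=> nab inf nxy yper.
have xNper : ~ is_periodic x.
  move=> xper; apply: inf; apply: sub_finite_set (generated2_normal nxy) _.
  by apply: finite_image2; exact: zexpg_finite.
have [k _ xyk] : range (zexpg x) (x ^ y)%g.
  rewrite -generated1 conjgE mulgA; case: nxy => _ _; apply.
    exact: sub_generated.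
  by apply: sub_generated; right.
have xyX n : (x ^ (y ^+ n))%g = zexpg x (k ^+ n).
  elim: n => [|n IHn]; first by rewrite conjg1.
  by rewrite expgSr conjgM IHn conj_zexpg -xyk -zexpgM -exprS.
have [n n_gt0 yn1] := yper.
have kn1 : k ^+ n = 1.
  apply/eqP; rewrite -subr_eq0; apply/eqP/(zexpg_eq1 xNper).
  by rewrite zexpgD zexpgN -xyX yn1 conjg1 mulgV.
(* Taking [n]-th powers is injective on naturals because [n] is positive. *)
have : `|k|%N == 1%N by rewrite -(eqn_exp2r _ _ n_gt0) -abszX kn1 exp1n.
(* [k = 0] contradicts the absolute value 1; a negative [k] is -1, which is the claim; [k = 1] would
   make the generators commute. *)
case: (intP k) xyk {kn1 xyX} => [//|m xyk|m <- /eqP]; last first.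
  by rewrite abszN /= => -[->].
move=> /eqP [m0]; case: nab; apply: generated_abelian.
have cxy : commute x y by rewrite /commute conjgC -xyk m0.
move=> _ _ [->|->] [->|->] //; exact: commute_sym.
Qed.

Lemma odd_zexpg_inverts x y i :
  (x ^ y = x^-1)%g -> odd (absz i) -> (x ^ zexpg y i = x^-1)%g.
Proof.
have odd_nat z (n : nat) : (x ^ z = x^-1)%g ->
    (x ^ (z ^+ n) = if odd n then x^-1 else x)%g.
  move=> xz; elim: n => [|n IHn]; first by rewrite conjg1.
  by rewrite expgSr conjgM IHn /=; case: odd; rewrite /= ?conjVg xz ?invgK.
case: i => n xy odd_n /=; first by rewrite odd_nat // odd_n.
(* For a negative exponent the parity argument is applied to the inverse of [y], which inverts [x]
   as well. *)
rewrite -expVgn odd_nat ?odd_n //.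
by rewrite -{1}[x]invgK -xy -conjVg conjgK.
Qed.

Lemma conjugate_zexpgM x y i j : (x ^ y = x^-1)%g ->
  odd (absz i) -> ~~ odd (absz j) ->
  is_conjugate (zexpg y i * zexpg x j)%g (zexpg y i).
Proof.
move=> xy odd_i even_j.
have [m ->] : exists m, j = m + m.
  case: j even_j => n even_n; first exists (n./2%:Z).
    by rewrite -PoszD addnn even_halfK.
  by exists (- n.+1./2%:Z); rewrite NegzE -opprD -PoszD addnn even_halfK.
(* Half of [j] is the conjugating exponent: x^(-m) y^i x^m = y^i (x^(-m))^(y^i) x^m = y^i x^(2m), as
   y^i inverts [x]. *)
exists (zexpg x m).
rewrite -zexpgN [(_ * zexpg y i)%g]conjgC conj_zexpg odd_zexpg_inverts //.
by rewrite -[(x^-1)%g]/(zexpg x (-1)) -zexpgM mulN1r opprK -mulgA -zexpgD.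
Qed.

Lemma periodic_has_order x : is_periodic x -> exists n, has_order x n.
Proof.
move=> xper; have exP : exists n, (0 < n)%N && `[< (x ^+ n = 1)%g >].
  by have [n n0 xn] := xper; exists n; rewrite n0; apply/asboolP.
case: (ex_minnP exP) => n /andP[n0 /asboolP xn] minn; exists n; split=> // m m0 xm.
by apply: minn; rewrite m0; apply/asboolP.
Qed.

Lemma has_order_inv x n : has_order x n -> has_order (x^-1)%g n.
Proof.
move=> [n0 xn minn]; split=> // [|m m0]; first by rewrite expVgn xn invg1.
by rewrite expVgn => xm; apply: minn => //; apply: invg_inj; rewrite xm invg1.
Qed.

Lemma has_order_conj x y n : is_conjugate x y -> has_order y n -> has_order x n.
Proof.
move=> [z ->] [n0 yn minn]; rewrite -mulgA -conjgE.
split=> // [|m m0]; first by rewrite -conjXg yn conj1g.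
by rewrite -conjXg => /eqP; rewrite conjg_eq1 => /eqP; exact: minn.
Qed.

End PeriodicNormalizer.

Theorem corollary3 (R : realType) (S : topologicalType) (g : nat)
    (g_ge2 : (2 <= g)%N) (S_surface : closed_orientable_surface R S g)
    (F G : Mod R S)
    (FG_nonabelian : ~ is_abelian (generated [set F; G]))
    (FG_infinite : infinite_set (generated [set F; G]))
    (FG_metacyclic : is_metacyclic (generated [set F; G]))
    (F_normal : is_normal (generated [set F]) (generated [set F; G]))
    (F_pA : pseudo_Anosov F)
    (G_nontrivial : G <> 1%g) (G_periodic : is_periodic G) :
  [/\ forall i j : int, odd (absz i) -> ~~ odd (absz j) ->
        is_conjugate (zexpg G i * zexpg F j)%g (zexpg G i),
      is_conjugate (G * F ^+ 2)%g G &
      exists (A B : Mod R S) (n : nat),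
        [/\ (F ^+ 2 = A * B)%g,
            A <> 1%g /\ is_periodic A,
            B <> 1%g /\ is_periodic B &
            has_order A n /\ has_order B n]].
Proof.
have FG : (F ^ G = F^-1)%g by exact: periodic_normalizer_inverts.
have conj2 : is_conjugate (G * F ^+ 2)%g G.
  (* The case i = 1, j = 2, where both integer powers compute to the natural ones. *)
  exact: (@conjugate_zexpgM _ F G (Posz 1) (Posz 2)).
split=> [i j odd_i even_j|//|]; first exact: conjugate_zexpgM.
have [n Gn] := periodic_has_order G_periodic.
have Vn := has_order_inv Gn; have Bn := has_order_conj conj2 Gn.
(* Both factors inherit the order of [G], one as its inverse and the other as its conjugate. *)
exists (G^-1)%g, (G * F ^+ 2)%g, n; split=> //; first by rewrite mulKg.
- split; first by move=> G1; apply: G_nontrivial; apply: invg_inj; rewrite G1 invg1.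
  by case: Vn => n0 Vn1 _; exists n.
- split; last by case: Bn => n0 Bn1 _; exists n.
  (* If the second factor were trivial, its conjugate [G] would be trivial too. *)
  move=> B1; case: conj2 => z; rewrite B1 -mulgA -conjgE => /esym/eqP.
  by rewrite conjg_eq1 => /eqP.
Qed.
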